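(* There is a constant $C>0$ such that, for every $d>0$, any triangle-free graph on $n$ vertices with minimum degree at least $d$ has list chromatic number at most $C\min\{\sqrt{n},\, (n\log n)/d\}$.
   Context: $\log$ is the natural logarithm. The list chromatic number of $G$ is the least $k$ such that for every assignment of lists of $k$ colours to the vertices there is a proper colouring choosing each vertex's colour from its list. *)

(* Defs.v *)
From HB Require Import structures.
From mathcomp Require Import all_boot all_order all_algebra finmap.
From mathcomp Require Import all_classical all_reals all_analysis.
Set Implicit Arguments.
Unset Strict Implicit.
Unset Printing Implicit Defensive.
Import Order.TTheory GRing.Theory Num.Theory.

Record sgraph := SGraph {
  vertex :> finType;
  adj : rel vertex;
  adj_sym : symmetric adj;
  adj_irrefl : irreflexive adj }.

Definition degree (G : sgraph) (v : G) : nat := #|[set w : G | adj v w]|.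

Definition min_degree_ge (R : realType) (G : sgraph) (d : R) : Prop :=
  forall v : G, (d <= (degree v)%:R)%R.

Definition triangle_free (G : sgraph) : Prop :=
  forall x y z : G, ~~ [&& adj x y, adj y z & adj x z].

Definition proper_colouring (G : sgraph) (K : Type) (c : G -> K) : Prop :=
  forall u v : G, adj u v -> c u <> c v.

(* Colours come from an arbitrary type, with no bound on the palette size. *)
Definition choosable (G : sgraph) (k : nat) : Prop :=
  forall (K : choiceType) (L : G -> {fset K}),
    (forall v, #|` L v| = k) ->
    exists2 c : G -> K, proper_colouring c & forall v, c v \in L v.

Lemma choosable_card (G : sgraph) : choosable G #|G|.
Proof.
move=> K L sizeL.
suff [c [cL cinj]] : exists c : G -> K, (forall v, c v \in L v) /\
    {in enum G &, injective c}.
  exists c => // u v uv /cinj; rewrite !mem_enum => /(_ isT isT) euv.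
  by move: uv; rewrite euv adj_irrefl.
have : (size (enum G) <= #|G|)%N by rewrite -cardE.
elim: (enum G) => [_|x s IH ltsG].
  have /choice[c cL] : forall v, exists k, k \in L v.
    move=> v; apply/fset0Pn; rewrite -cardfs_gt0 sizeL.
    by apply/card_gt0P; exists v.
  by exists c.
have [c [cL cinj]] := IH (ltnW ltsG).
have [xs|xNs] := boolP (x \in s).
  exists c; split=> // u v; rewrite !inE => us vs; apply: cinj.
  - by case/orP: us => [/eqP->|].
  - by case/orP: vs => [/eqP->|].
have [k kL kNs] : exists2 k, k \in L x & k \notin [seq c v | v <- s].
  apply: contrapT => H.
  have : {subset L x <= [seq c v | v <- s]}.
    by move=> k kL; apply/negPn/negP => kN; apply: H; exists k.
  move=> /(uniq_leq_size (fset_uniq _)).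
  by rewrite size_map sizeL leqNgt ltsG.
exists (fun v => if v == x then k else c v); split.
  by move=> v; case: eqP => [->|].
move=> u v; rewrite !inE.
case: eqVneq => [->|ux]; case: eqVneq => [->|vx] //= us vs.
- by move=> kE; move: kNs; rewrite kE map_f.
- by move=> kE; move: kNs; rewrite -kE map_f.
- exact: cinj.
Qed.

Lemma ex_choosable (G : sgraph) : exists k, `[< choosable G k >].
Proof. by exists #|G|; apply/asboolP; exact: choosable_card. Qed.

Definition list_chromatic_number (G : sgraph) : nat := ex_minn (ex_choosable G).

(* Main.v *)
(* Bound [sqrt n]: as long as some colour is available at more than [s ~ sqrt n]
   neighbours of a vertex, give them all that colour (they are independent) and
   delete it elsewhere; this happens at most [n / s] times. Afterwards every
   vertex competes with at most [s] neighbours for each colour, and lists of size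
   [4 s] suffice by Rosenfeld's counting version of the local lemma.

   Bound [n ln n / d]: attach to each colour a uniformly random vertex and only
   use the colour on its neighbourhood, which is independent. A vertex with [k]
   colours in its list can use none of them with probability at most
   [(1 - d / n) ^ k], which is below [1 / n] as soon as [k > n ln n / d]. *)

Require Import Defs.
From mathcomp Require Import all_boot all_order all_algebra finmap.
From mathcomp Require Import all_classical all_reals all_analysis.
From mathcomp Require Import zify ring lra.
Import Order.TTheory GRing.Theory Num.Theory.

Set Implicit Arguments.
Unset Strict Implicit.
Unset Printing Implicit Defensive.

Lemma card_bigcup_leq (I T : finType) (A : {pred I}) (B : I -> {set T}) :
  #|\bigcup_(i in A) B i| <= \sum_(i in A) #|B i|.
Proof.
elim/big_rec2: _ => [|i p q _ le]; first by rewrite cards0.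
by rewrite cardsU; lia.
Qed.

(** * Counting list colourings of induced subgraphs *)

Section ListColourings.
Variables (G : sgraph) (K : finType).
Implicit Types (L : G -> {set K}) (S U : {set G}) (f : {ffun G -> option K}).

(* A colouring of the subgraph induced by [S] is encoded as a partial function
   with domain exactly [S], so that restrictions can be counted. *)
Definition list_colourings L S : {set {ffun G -> option K}} :=
  [set f : {ffun G -> option K} |
    [forall v, if v \in S then [exists c in L v, f v == Some c]
                      else f v == None]
           && [forall u, forall v, adj u v && (f u == f v) ==> (f u == None)]].

Lemma list_colouringsP L S f :
  reflect [/\ forall v, v \in S -> exists2 c, c \in L v & f v = Some c,
              forall v, v \notin S -> f v = None &
              forall u v c, adj u v -> f u = Some c -> f v <> Some c]
          (f \in list_colourings L S).
Proof.
rewrite inE; apply: (iffP andP)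
    => [[/forallP dom /forallP prop]|[din dout prop]].
  split=> [v vS|v vS|u v c uv fu fv].
  - by have := dom v; rewrite vS => /exists_inP[c cL /eqP fv]; exists c.
  - by have := dom v; rewrite (negPf vS) => /eqP.
  - by have /forallP/(_ v) := prop u; rewrite uv fu fv eqxx.
split; apply/forallP; [move=> v|move=> u].
  case: ifPn => [/din[c cL ->]|/dout-> //].
  by apply/exists_inP; exists c.
apply/forallP => v; apply/implyP => /andP[uv /eqP fuv].
case fu: (f u) => [c|//].
by case: (prop u v c uv fu); rewrite -fuv.
Qed.

Definition recolour f v o : {ffun G -> option K} :=
  [ffun w => if w == v then o else f w].

Lemma card_list_colourings0 L : 0 < #|list_colourings L finset.set0|.
Proof.
apply/card_gt0P; exists [ffun=> None]; apply/list_colouringsP; split.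
- by move=> v; rewrite inE.
- by move=> v _; rewrite ffunE.
- by move=> u v c _; rewrite ffunE.
Qed.

(* A colouring in which [u] has the prescribed colour [c] is determined by its
   restriction to the other vertices. *)
Lemma card_list_colourings_fixed L S u c :
  #|[set f in list_colourings L S | f u == Some c]|
    <= #|list_colourings L (S :\ u)|.
Proof.
rewrite -(card_in_imset (f := fun f => recolour f u None)); last first.
  move=> f g; rewrite !inE => /andP[_ /eqP fu] /andP[_ /eqP gu] /ffunP fg.
  apply/ffunP => w; have [->|wu] := eqVneq w u; first by rewrite fu gu.
  by have := fg w; rewrite !ffunE (negPf wu).
apply/subset_leq_card/fintype.subsetP => _ /imsetP[f + ->].
rewrite inE => /andP[/list_colouringsP[din dout prop] _].
apply/list_colouringsP; split=> [v|v|x y e xy].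
- by rewrite in_setD1 ffunE => /andP[/negPf-> /din].
- by rewrite in_setD1 ffunE negb_and negbK; case: eqP => //= _ /dout.
- by rewrite !ffunE; case: eqP => // _; case: eqP => // _; exact: prop.
Qed.

(** Classify the colourings of [v |: S] by the colour of [v]: for each [c] in [L v], recolouring [v]
    with [c] injects the colourings of [S] that avoid [c] around [v] into the class of [c]. *)
Lemma card_list_colourings_extend L S v : v \notin S ->
  \sum_(c in L v) #|[set f in list_colourings L S |
                      [forall u, adj v u ==> (f u != Some c)]]|
    <= #|list_colourings L (v |: S)|.
Proof.
move=> vS.
rewrite -[leqRHS]sum1_card (partition_big (fun f => f v) xpredT) //=.
rewrite (bigID (mem [set Some c | c in L v])) /= big_imset /=; last first.
  by move=> c e _ _ [].
apply: leq_trans (leq_addr _ _); apply: leq_sum => c cL.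
rewrite sum1_card; set A := [set f in list_colourings L S | _].
have <- : #|[set recolour f v (Some c) | f in A]| = #|A|.
  apply: card_in_imset.
  move=> f g; rewrite !inE => /andP[/andP[/forallP/(_ v) fv _] _].
  move=> /andP[/andP[/forallP/(_ v) gv _] _] /ffunP fg.
  move: fv gv; rewrite (negPf vS) => /eqP fv /eqP gv.
  apply/ffunP => w; have [->|wu] := eqVneq w v; first by rewrite fv gv.
  by have := fg w; rewrite !ffunE (negPf wu).
apply/subset_leq_card/fintype.subsetP => _ /imsetP[f + ->].
rewrite inE => /andP[/list_colouringsP[din dout prop] /forallP free].
rewrite unfold_in ffunE !eqxx andbT.
apply/list_colouringsP; split=> [w|w|x y e xy].
- by rewrite in_setU1 ffunE; case: eqP => [-> _|_ /= /din//]; exists c.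
- by rewrite in_setU1 ffunE negb_or => /andP[/negPf-> /dout].
- rewrite !ffunE; case: eqP => [xv [<-]|_]; case: eqP => [yv|_].
  + by move: xy; rewrite xv yv adj_irrefl.
  + by have := free y; rewrite -xv xy => /eqP.
  + move=> + [ce]; rewrite -ce; have := free x; rewrite -yv adj_sym xy.
    by move=> /eqP.
  + exact: prop.
Qed.

(* Rosenfeld's counting argument: adding a vertex multiplies the number of list
   colourings by at least half the size of the lists. *)
Lemma list_colourings_growth L U s v S :
  0 < s ->
  (forall w, w \in U -> 4 * s <= #|L w|) ->
  (forall w c, w \in U -> c \in L w ->
     #|[set u in U | adj w u && (c \in L u)]| <= s) ->
  v \in U -> S \subset U -> v \notin S ->
  2 * s * #|list_colourings L S| <= #|list_colourings L (v |: S)|.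
Proof.
move=> s0 sizeL cdeg; have [m] := ubnP #|S|.
elim: m S v => // m IH S v ltSm vU SU vS.
apply: leq_trans (card_list_colourings_extend L vS).
set N := #|list_colourings L S|.
(* Each colour of [v] is free at [v] in at least half of the colourings of [S]; with at least
   [4 * s] colours this yields the factor [2 * s]. *)
suff half c : c \in L v -> N <= 2 * #|[set f in list_colourings L S |
                      [forall u, adj v u ==> (f u != Some c)]]|.
  have h : \sum_(c in L v) N <= 2 * \sum_(c in L v) #|[set f in
      list_colourings L S | [forall u, adj v u ==> (f u != Some c)]]|.
    by rewrite big_distrr /=; apply: leq_sum.
  rewrite sum_nat_const in h; have := sizeL v vU; nia.
move=> cL.
set A := [set f in _ | _].
pose B u := [set f in list_colourings L S | f u == Some c].
pose W := [set u in U | adj v u && (c \in L u)].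
have cover : list_colourings L S \subset A :|: \bigcup_(u in W :&: S) B u.
  apply/fintype.subsetP => f fS; rewrite inE orbC -implyNb; apply/implyP => fB.
  rewrite inE fS; apply/forallP => u; apply/implyP => vu.
  apply: contra fB => /eqP fu; apply/bigcupP; exists u; last first.
    by rewrite inE fS fu eqxx.
  case/list_colouringsP: fS => din dout _.
  have uS : u \in S by apply: contraT => /dout; rewrite fu.
  have [e eL] := din u uS; rewrite fu => -[ce].
  by rewrite !inE uS vu (fintype.subsetP SU) // ce eL.
(* By induction, prescribing the colour of [u] costs a factor [2 * s], so the at most [s]
   competitors in [W] together block [c] in at most half of the colourings. *)
have sizeB u : u \in W :&: S -> 2 * s * #|B u| <= N.
  rewrite !inE => /andP[_ uS].
  apply: (leq_trans (n := 2 * s * #|list_colourings L (S :\ u)|)).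
    by rewrite leq_mul2l card_list_colourings_fixed orbT.
  rewrite /N -{2}(finset.setD1K uS); apply: IH.
  - by have := cardsD1 u S; rewrite uS; lia.
  - exact: (fintype.subsetP SU).
  - exact: fintype.subset_trans (finset.subsetDl _ _) SU.
  - by rewrite !inE eqxx.
have sumB : 2 * s * \sum_(u in W :&: S) #|B u| <= s * N.
  rewrite big_distrr /=.
  apply: (leq_trans (n := \sum_(u in W :&: S) N)); first exact: leq_sum.
  rewrite sum_nat_const leq_mul2r; apply/orP; right.
  by apply: leq_trans (cdeg v c vU cL); apply/subset_leq_card/finset.subsetIl.
have : N <= #|A| + \sum_(u in W :&: S) #|B u|.
  apply: (leq_trans (subset_leq_card cover)).
  rewrite cardsU; apply: leq_trans (leq_subr _ _) _; rewrite leq_add2l.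
  exact: card_bigcup_leq.
nia.
Qed.

Lemma list_colouring_colour_degree L U s :
  0 < s ->
  (forall w, w \in U -> 4 * s <= #|L w|) ->
  (forall w c, w \in U -> c \in L w ->
     #|[set u in U | adj w u && (c \in L u)]| <= s) ->
  exists f, f \in list_colourings L U.
Proof.
move=> s0 sizeL cdeg.
suff pos m S : #|S| < m -> S \subset U -> 0 < #|list_colourings L S|.
  by apply/card_gt0P; apply: (pos #|U|.+1).
elim: m S => // m IH S ltSm SU.
have [->|[v vS]] := finset.set_0Vmem S; first exact: card_list_colourings0.
rewrite -(finset.setD1K vS).
have DU : S :\ v \subset U.
  by apply: fintype.subset_trans (finset.subsetDl _ _) SU.
apply: leq_trans (list_colourings_growth s0 sizeL cdeg _ DU _).
- rewrite muln_gt0 muln_gt0 s0 /=; apply: IH => //.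
  by have := cardsD1 v S; rewrite vS; lia.
- exact: (fintype.subsetP SU).
- by rewrite !inE eqxx.
Qed.

(** * Peeling off popular colours *)

(** The surplus [#|U| %/ s] pays for the rounds: each removes more than [s] vertices from [U] and at
    most one colour from each list. Once no colour is popular, [4 * s] colours suffice. *)
Lemma list_colouring_peel L U s :
  0 < s -> triangle_free G ->
  (forall w, w \in U -> 4 * s + #|U| %/ s <= #|L w|) ->
  exists f, f \in list_colourings L U.
Proof.
move=> s0 tf; have [m] := ubnP #|U|; elim: m L U => // m IH L U ltUm sizeL.
have [cdeg|] := boolP [forall w, forall c,
    #|[set u in U | adj w u && (c \in L u)]| <= s].
  apply: (list_colouring_colour_degree s0) => [w wU|w c _ _].
    by apply: leq_trans (sizeL w wU); rewrite leq_addr.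
  by move/forallP/(_ w)/forallP: cdeg; apply.
rewrite negb_forall => /existsP[w]; rewrite negb_forall => /existsP[c].
rewrite -ltnNge; set W := [set _ in _ | _] => ltsW.
have WU : W \subset U by apply/fintype.subsetP => u; rewrite inE => /andP[].
have sizeU := cardsD U W; rewrite (finset.setIidPr WU) in sizeU.
have leWU := subset_leq_card WU.
have [||f /list_colouringsP[din dout prop]] :=
    IH (fun u => L u :\ c) (U :\: W).
- lia.
- move=> u; rewrite inE => /andP[_ uU].
  have := sizeL u uU; have := cardsD1 c (L u).
  have : #|U :\: W| %/ s + 1 <= #|U| %/ s.
    by rewrite addnC -divnMDl // mul1n leq_div2r //; lia.
  by case: (c \in L u); lia.
(* [W] lies in the neighbourhood of [w], so it is independent, and [f] never uses [c]. *)
exists [ffun u => if u \in W then Some c else f u].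
apply/list_colouringsP; split=> [u uU|u uU|x y e xy].
- rewrite ffunE; case: ifPn => [|uW].
    by rewrite inE => /and3P[_ _ cu]; exists c.
  have [|e] := din u; first by rewrite inE uW.
  by rewrite in_setD1 => /andP[_ eL] fu; exists e.
- rewrite ffunE (negPf (contra (fintype.subsetP WU u) uU)); apply: dout.
  by rewrite inE (negPf uU) andbF.
- have neqc u : f u <> Some c.
    move=> fu; have [/din[b]|/dout] := boolP (u \in U :\: W); rewrite fu //.
    by rewrite in_setD1 => /andP[/eqP bc _] [cb]; apply: bc.
  rewrite !ffunE; case: ifPn => [xW [<-]|_]; case: ifPn => [yW|_] //.
  + move: xW yW; rewrite !inE => /and3P[_ wx _] /and3P[_ wy _].
    by have := tf w x y; rewrite wx xy wy.
  + by move=> + [ce]; rewrite -ce; apply: neqc.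
  + exact: prop.
Qed.

(** * Attaching neighbourhoods to colours *)

(* Each colour [c] may only be used on the neighbourhood of [t c], which is
   independent. *)
Lemma colouring_of_neighbourhoods L (t : K -> G) :
  triangle_free G ->
  (forall v, exists2 c, c \in L v & adj (t c) v) ->
  exists2 f : G -> K, proper_colouring f & forall v, f v \in L v.
Proof.
move=> tf tL.
have /choice[f fP] : forall v, exists c, c \in L v /\ adj (t c) v.
  by move=> v; have [c] := tL v; exists c.
exists f => [u v uv fuv|v]; last by have [] := fP v.
have [_ tu] := fP u; have [_ tv] := fP v.
by have := tf (t (f u)) u v; rewrite tu uv fuv tv.
Qed.

(** Union bound by counting: a map is bad for [v] if it sends all of [L v] to the at most [m]
    vertices not adjacent to [v]. Summed over [v], the bad maps are fewer than all maps. *)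
Lemma neighbourhood_hitting_map L k m :
  0 < #|G| -> (forall v, #|L v| = k) -> (forall v : G, #|G| <= degree v + m) ->
  #|G| * m ^ k < #|G| ^ k ->
  exists t : K -> G, forall v, exists2 c, c \in L v & adj (t c) v.
Proof.
move=> G0 sizeL degm small.
pose miss v := [set t : {ffun K -> G} | [forall c in L v, ~~ adj (t c) v]].
pose far v : pred G := fun w => ~~ adj w v.
have card_far v : #|far v| <= m.
  have := cardC [set w | adj v w]; have := degm v; rewrite /degree.
  suff -> : #|[predC [set w | adj v w]]| = #|far v| by lia.
  by apply: eq_card => w; rewrite !inE unfold_in /far adj_sym.
have card_miss v : #|miss v| <= m ^ k * #|G| ^ (#|K| - k).
  (* [miss v] is a product set: [t c] is confined to [far v] for [c] in [L v] and arbitrary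
     otherwise. *)
  pose F c : pred G := if c \in L v then far v else predT.
  have -> : #|miss v| = #|(family F : simpl_pred {ffun K -> G})|.
    apply: eq_card => t; rewrite inE; apply/forallP/familyP => h c.
      by have := h c; rewrite /F; case: (c \in L v).
    by apply/implyP => cL; have := h c; rewrite /F cL.
  have -> : #|K| - k = #|[predC L v]| by rewrite -(cardC (L v)) sizeL addKn.
  rewrite card_family foldrE big_image /= (bigID (mem (L v))) /= -(sizeL v).
  rewrite -!prod_nat_const; apply: leq_mul; apply: leq_prod => c cL.
    by rewrite /F cL.
  exact: max_card.
have [t tP] : exists t, t \notin \bigcup_v miss v.
  apply/existsP; rewrite -negb_forall; apply/negP => /forallP full.
  have /card_gt0P[v _] := G0.
  have leK : k <= #|K| by rewrite -(sizeL v) max_card.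
  suff : #|G| ^ #|K| <= #|G| * (m ^ k * #|G| ^ (#|K| - k)).
    rewrite -{1}(subnKC leK) expnD mulnA leq_pmul2r ?expn_gt0 ?G0 //.
    by rewrite leqNgt small.
  rewrite -card_ffun -sum_nat_const.
  apply: (leq_trans (n := #|\bigcup_v miss v|)).
    by apply/subset_leq_card/fintype.subsetP => t _; exact: full.
  by apply: leq_trans (card_bigcup_leq _ _) _; apply: leq_sum.
exists t => v; have : t \notin miss v.
  by apply: contra tP => tv; apply/bigcupP; exists v.
rewrite inE negb_forall_in => /exists_inP[c cL]; rewrite negbK => tc.
by exists c.
Qed.

End ListColourings.

(** * From finite palettes to choosability *)

(** Only colours in the finite union [B] of the lists matter, so counting over a finite palette is
    enough. *)
Lemma choosable_finType (G : sgraph) (k : nat) :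
  (forall (K : finType) (L : G -> {set K}), (forall v, #|L v| = k) ->
    exists2 c : G -> K, proper_colouring c & forall v, c v \in L v) ->
  choosable G k.
Proof.
move=> fin K L sizeL; pose B := \big[fsetU/fset0]_(v : G) L v.
have LB v : (L v `<=` B)%fset by apply: bigfcup_sup; rewrite ?mem_index_enum.
have [v|c cprop cL] := fin B (fun v => fsub B (L v)).
  by rewrite card_fsub // sizeL.
exists (fun v => val (c v)) => [u v uv /val_inj|v]; first exact: cprop.
by rewrite -in_fsub.
Qed.

Lemma list_chromatic_number_leq (G : sgraph) (k : nat) :
  choosable G k -> list_chromatic_number G <= k.
Proof.
move=> Gk; rewrite /list_chromatic_number.
by case: ex_minnP => m _; apply; apply/asboolP.
Qed.

(** Here the peeling surplus is at most [s], whence [4 * s + s]. *)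
Lemma choosable_sqrt (G : sgraph) (s : nat) :
  triangle_free G -> #|G| <= s ^ 2 -> choosable G (5 * s).
Proof.
move=> tf Gs; have [s0|s_gt0] := posnP s.
  have -> : 5 * s = #|G| by rewrite s0 in Gs *; lia.
  exact: choosable_card.
apply: choosable_finType => K L sizeL.
have [v _|f /list_colouringsP[din _ prop]] :=
    @list_colouring_peel _ _ L [set: G] s s_gt0 tf.
  have : #|[set: G]| %/ s <= s.
    by rewrite cardsT -[leqRHS](mulKn _ s_gt0) leq_div2r.
  by rewrite sizeL; lia.
have /choice[c cP] : forall v, exists c, c \in L v /\ f v = Some c.
  by move=> v; have [|c] := din v; rewrite ?inE //; exists c.
exists c => [u v uv cuv|v]; last by have [] := cP v.
have [_ fu] := cP u; have [_ fv] := cP v.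
by apply: (prop u v (c u) uv fu); rewrite fv cuv.
Qed.

Lemma choosable_min_degree (G : sgraph) (k m : nat) :
  0 < #|G| -> triangle_free G -> (forall v : G, #|G| <= degree v + m) ->
  #|G| * m ^ k < #|G| ^ k -> choosable G k.
Proof.
move=> G0 tf degm small; apply: choosable_finType => K L sizeL.
have [t tL] := neighbourhood_hitting_map G0 sizeL degm small.
exact: colouring_of_neighbourhoods tL.
Qed.

(** * Real estimates and the two bounds *)

Local Open Scope ring_scope.

Lemma ln2_ge_half (R : realType) : 1 / 2 <= ln (2 : R).
Proof.
have : ln (1 + (- (1 / 2) : R)) <= - (1 / 2) by apply: le_ln1Dx; lra.
have -> : (1 + (- (1 / 2) : R)) = 2^-1 by field.
by rewrite lnV ?posrE //; lra.
Qed.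

Lemma list_chromatic_number_sqrt (R : realType) (G : sgraph) :
  triangle_free G ->
  (list_chromatic_number G)%:R <= 10 * Num.sqrt (#|G|%:R : R).
Proof.
move=> tf; have [G0|G0] := posnP #|G|.
  have := list_chromatic_number_leq (@choosable_card G).
  by rewrite G0 leqn0 => /eqP ->; rewrite sqrtr0 mulr0.
set r := Num.sqrt _; have r1 : 1 <= r.
  by rewrite -sqrtr1 ler_wsqrtr // ler1n.
have r2 : r ^+ 2 = #|G|%:R by rewrite sqr_sqrtr.
(* As [1 <= r], we get [s <= r + 1 <= 2 * r], hence the constant 10. *)
set s := (Num.trunc r).+1.
have /andP[s_le s_gt] : (Num.trunc r)%:R <= r < s%:R.
  by apply: truncn_itv; lra.
have Gs : (#|G| <= s ^ 2)%N by rewrite -(ler_nat R) natrX -r2; nra.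
have := list_chromatic_number_leq (choosable_sqrt tf Gs).
rewrite -(ler_nat R) natrM => /le_trans; apply.
by rewrite /s -natr1; nra.
Qed.

(** From [1 - x / n <= expR (- (x / n))], the ratio of the two sides is at most
    [expR (ln n - k * x / n)], whose exponent is negative. *)
Lemma union_bound_lt1 (R : realType) (n k : nat) (x : R) :
  (0 < n)%N -> 0 <= x <= n%:R -> n%:R * ln n%:R < k%:R * x ->
  n%:R * (n%:R - x) ^+ k < n%:R ^+ k.
Proof.
move=> n0 /andP[x0 xn] kx.
have N0 : 0 < n%:R :> R by rewrite ltr0n.
have le_exp : n%:R - x <= n%:R * expR (- (x / n%:R)).
  have := expR_ge1Dx (- (x / n%:R)); rewrite -(ler_pM2l N0).
  by rewrite mulrDr mulr1 mulrN mulrCA divff ?mulr1 // gt_eqF.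
have : (n%:R - x) ^+ k <= (n%:R * expR (- (x / n%:R))) ^+ k.
  by rewrite lerXn2r ?nnegrE ?subr_ge0 // mulr_ge0 ?expR_ge0 // ltW.
rewrite exprMn -expRM_natl => le_pow.
apply: (@le_lt_trans _ _ (n%:R * (n%:R ^+ k * expR (k%:R * - (x / n%:R))))).
  by rewrite ler_pM2l.
rewrite mulrCA gtr_pMr ?exprn_gt0 // -[X in X * expR _](lnK (x := n%:R)) //.
rewrite -expRD expR_lt1 -(pmulr_rlt0 _ N0).
have -> : n%:R * (ln n%:R + k%:R * - (x / n%:R)) = n%:R * ln n%:R - k%:R * x.
  by field; rewrite gt_eqF.
by rewrite subr_lt0.
Qed.

Lemma list_chromatic_number_min_degree (R : realType) (G : sgraph) (d : R) :
  0 < d -> triangle_free G -> min_degree_ge G d ->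
  (list_chromatic_number G)%:R <= 3 * (#|G|%:R * ln #|G|%:R / d).
Proof.
move=> d0 tf dG; have [G0|G0] := posnP #|G|.
  have := list_chromatic_number_leq (@choosable_card G).
  by rewrite G0 leqn0 => /eqP ->; rewrite mul0r mul0r mulr0.
set n := #|G|.
have deg_lt (v : G) : (degree v < n)%N.
  rewrite /degree /n -cardsT; apply/proper_card/properP; split.
    exact: finset.subsetT.
  by exists v; rewrite inE // adj_irrefl.
have /card_gt0P[v0 _] := G0.
(* The real [d] is replaced by the true minimum degree [D], so that [n - D] is a natural number. *)
have [v _ vmin] := @arg_minnP _ v0 xpredT (@degree G) isT.
set D := degree v; have dD : d <= D%:R := dG v.
have D0 : (0 < D)%N by rewrite -(ltr0n R); exact: lt_le_trans dD.
have Dn : (D < n)%N := deg_lt v.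
have n2 : (2 <= n)%N by lia.
have ln_ge : 1 / 2 <= ln (n%:R : R).
  apply: le_trans (ln2_ge_half R) _.
  by rewrite ler_ln ?posrE ?ltr0n ?ler_nat //; lia.
have nd : 1 <= n%:R / d.
  by rewrite ler_pdivlMr // mul1r; apply: le_trans dD _; rewrite ler_nat ltnW.
(* [1 / 2 <= y] gives [k <= y + 1 <= 3 * y], hence the constant 3. *)
set y := n%:R * ln n%:R / d; have y_ge : 1 / 2 <= y.
  by rewrite /y mulrAC; nra.
set k := (Num.trunc y).+1.
have /andP[k_le k_gt] : (Num.trunc y)%:R <= y < k%:R.
  by apply: truncn_itv; lra.
have Gk : choosable G k.
  apply: (@choosable_min_degree G k (n - D)) => // [w|].
    by have := vmin w isT; rewrite -/n -/D; lia.
  rewrite -/n -(ltr_nat R) natrM !natrX natrB; last exact: ltnW.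
  apply: union_bound_lt1 => //; first by rewrite ler0n ler_nat ltnW.
  apply: (@lt_le_trans _ _ (k%:R * d)).
    by rewrite -ltr_pdivrMr.
  by rewrite ler_wpM2l.
have := list_chromatic_number_leq Gk; rewrite -(ler_nat R) => /le_trans; apply.
by rewrite /k -natr1; lra.
Qed.

Theorem theorem1p6 (R : realType) :
  exists2 C : R, 0 < C &
    forall (d : R) (n : nat) (G : sgraph),
      0 < d -> #|G| = n -> triangle_free G -> min_degree_ge G d ->
      (list_chromatic_number G)%:R
        <= C * Num.min (Num.sqrt n%:R) (n%:R * ln n%:R / d).
Proof.
exists 10 => // d n G d0 <- tf dG.
have b1 := list_chromatic_number_sqrt R tf.
have b2 := list_chromatic_number_min_degree d0 tf dG.
(* With [b2], this makes [n * ln n / d] nonnegative, so its factor 3 may be raised to 10. *)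
have := ler0n R (list_chromatic_number G).
by rewrite /Num.min; case: ifP => _; lra.
Qed.
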